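(* The category of subcomplete locally refinable Boolean partition algebras (with partition homomorphisms as morphisms) is equivalent to the category of ultraparacompact frames (with frame homomorphisms as morphisms).
   Context: For subsets $R,S$ of a poset, $R\preceq S$ ($R$ refines $S$) means that for each $r\in R$ there is $s\in S$ with $r\leq s$. A partition of a Boolean algebra $B$ is a subset $p\subseteq B\setminus\{0\}$ with $\bigvee p=1$ such that $a\wedge b=0$ whenever $a,b\in p$, $a\neq b$; a partition of an element $a\in B$ is a set of pairwise disjoint nonzero elements of $B$ with least upper bound $a$. The partitions of $B$ form a meet-semilattice under $\preceq$, with $p\wedge q=\{a\wedge b\mid a\in p,b\in q\}\setminus\{0\}$. A Boolean partition algebra is a pair $(B,F)$ where $B$ is a Boolean algebra and $F$ is a filter on the meet-semilattice of partitions of $B$ such that $B=\{0\}\cup\bigcup F$. A partition homomorphism from $(A,F)$ to $(B,G)$ is a Boolean algebra homomorphism $\phi:A\to B$ such that $\phi[p]^{+}\in G$ whenever $p\in F$, where $\phi[p]^{+}=\phi[p]\setminus\{0\}$. A partition $p$ of $B$ is subcomplete if $\bigvee R$ exists in $B$ for every $R\subseteq p$. A Boolean partition algebra $(B,F)$ is subcomplete if each $p\in F$ is subcomplete. It is locally refinable if whenever $p\in F$, $|p|>1$, and for each $a\in p$, $p_a$ is a partition of $a$ with $p_a\cup\{a'\}\in F$ (where $a'$ is the complement of $a$), then $\bigcup_{a\in p}p_a\in F$. A frame is a complete lattice satisfying $x\wedge\bigvee_{i\in I}y_i=\bigvee_{i\in I}(x\wedge y_i)$; frame homomorphisms preserve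 finite meets and arbitrary joins. An element $x$ of a frame $L$ is complemented if there is $y\in L$ with $x\wedge y=0$ and $x\vee y=1$; $\mathfrak{B}(L)$ is the set of complemented elements. A frame $L$ is zero-dimensional if $x=\bigvee\{y\in\mathfrak{B}(L)\mid y\leq x\}$ for each $x\in L$. A cover of $L$ is a subset $C\subseteq L$ with $\bigvee C=1$; a partition of $L$ is a subset $p\subseteq L\setminus\{0\}$ with $\bigvee p=1$ and $a\wedge b=0$ for distinct $a,b\in p$. A zero-dimensional frame $L$ is ultraparacompact if every cover of $L$ is refined by some partition of $L$. *)

(* Defs.v *)
From HB Require Import structures.
From mathcomp Require Import all_boot all_order.
From mathcomp Require Import boolp classical_sets.

Set Implicit Arguments.
Unset Strict Implicit.
Unset Printing Implicit Defensive.

Import Order.TTheory.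

Local Open Scope classical_set_scope.
Local Open Scope order_scope.

(* Equality of morphisms is Leibniz equality; hom types below are bundled     *)
(* functions, so it amounts to pointwise equality.                            *)
Record category := Category {
  obj :> Type;
  hom : obj -> obj -> Type;
  idm : forall x, hom x x;
  comp : forall x y z, hom y z -> hom x y -> hom x z;
  comp_idl : forall x y (f : hom x y), comp (idm y) f = f;
  comp_idr : forall x y (f : hom x y), comp f (idm x) = f;
  comp_assoc : forall x y z t (f : hom z t) (g : hom y z) (h : hom x y),
    comp f (comp g h) = comp (comp f g) h }.

Record functor (C D : category) := Functor {
  fobj :> C -> D;
  fmap : forall x y, hom x y -> hom (fobj x) (fobj y);
  fmap_id : forall x, fmap (idm x) = idm (fobj x);
  fmap_comp : forall x y z (f : hom y z) (g : hom x y),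
    fmap (comp f g) = comp (fmap f) (fmap g) }.

Definition functor_id (C : category) : functor C C :=
  @Functor C C (fun x => x) (fun _ _ f => f)
    (fun=> erefl) (fun _ _ _ _ _ => erefl).

Section FunctorComp.
Variables (C D E : category) (G : functor D E) (F : functor C D).

Fact functor_comp_id x : fmap G (fmap F (idm x)) = idm (G (F x)).
Proof. by rewrite !fmap_id. Qed.

Fact functor_comp_comp x y z (f : hom y z) (g : hom x y) :
  fmap G (fmap F (comp f g)) = comp (fmap G (fmap F f)) (fmap G (fmap F g)).
Proof. by rewrite !fmap_comp. Qed.

Definition functor_comp : functor C E :=
  @Functor C E (fun x => G (F x)) (fun _ _ f => fmap G (fmap F f))
    functor_comp_id functor_comp_comp.

End FunctorComp.

Definition isomorphism (C : category) (x y : C) (f : hom x y) : Prop :=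
  exists g : hom y x, comp g f = idm x /\ comp f g = idm y.

Definition naturally_isomorphic (C D : category) (F G : functor C D) : Prop :=
  exists eta : forall x : C, hom (F x) (G x),
    (forall (x y : C) (f : hom x y),
       comp (eta y) (fmap F f) = comp (fmap G f) (eta x)) /\
    (forall x, isomorphism (eta x)).

Definition equivalent_categories (C D : category) : Prop :=
  exists (F : functor C D) (G : functor D C),
    naturally_isomorphic (functor_comp G F) (functor_id C) /\
    naturally_isomorphic (functor_comp F G) (functor_id D).

Definition full_subcategory (C : category) (P : C -> Prop) : category :=
  @Category {x : C | P x} (fun x y => hom (sval x) (sval y))
    (fun x => idm (sval x)) (fun _ _ _ f g => comp f g)
    (fun _ _ => @comp_idl C _ _) (fun _ _ => @comp_idr C _ _)
    (fun _ _ _ _ => @comp_assoc C _ _ _ _).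

Definition refines d (T : porderType d) (R S : set T) : Prop :=
  forall r, R r -> exists2 s, S s & r <= s.

Section Partitions.
Context d (L : tbLatticeType d).
Implicit Types (a : L) (p q : set L).

Definition partition_of a p : Prop :=
  [/\ ~ p \bot,
      forall x y, p x -> p y -> x <> y -> Order.meet x y = \bot
    & supremums p a].

Definition is_partition p : Prop := partition_of \top p.

Definition partition_meet p q : set L :=
  [set Order.meet a b | a in p & b in q] `\ \bot.

(* A filter is nonempty, but it may be the improper one: F can contain a      *)
(* least partition, or all partitions.                                        *)
Definition is_partition_filter (F : set (set L)) : Prop :=
  [/\ F `<=` is_partition,
      F !=set0,
      forall p q, F p -> is_partition q -> refines p q -> F q
    & forall p q, F p -> F q -> F (partition_meet p q)].

End Partitions.

(* Boolean algebras are ctbDistrLatticeType; the one-element algebra, with    *)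
(* F = {set0}, is not excluded.                                               *)
Section BooleanPartitionAlgebras.
Context d (B : ctbDistrLatticeType d).
Implicit Types (F : set (set B)) (p : set B).

Definition is_bpa F : Prop :=
  is_partition_filter F /\ [set: B] = \bot |` \bigcup_(p in F) p.

Definition subcomplete_partition p : Prop :=
  forall R, R `<=` p -> supremums R !=set0.

Definition subcomplete F : Prop := forall p, F p -> subcomplete_partition p.

Definition locally_refinable F : Prop :=
  forall p (P : B -> set B),
    F p -> (exists a b, [/\ p a, p b & a <> b]) ->
    (forall a, p a -> partition_of a (P a) /\ F (Order.compl a |` P a)) ->
    F (\bigcup_(a in p) P a).

End BooleanPartitionAlgebras.

(* The bundled {tblmorphism A -> B} only records preservation of \bot and     *)
(* \top, hence the explicit list.                                             *)
Definition boolean_morphism d (A : ctbDistrLatticeType d)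
    d' (B : ctbDistrLatticeType d') (f : A -> B) : Prop :=
  [/\ f \bot = \bot, f \top = \top, Order.meet_morphism f,
      Order.join_morphism f & {morph f : x / Order.compl x}].

Record bpa := Bpa {
  bpa_disp : Order.disp_t;
  bpa_alg :> ctbDistrLatticeType bpa_disp;
  bpa_filter : set (set bpa_alg);
  bpaP : is_bpa bpa_filter }.

Definition partition_morphism (A B : bpa) (f : A -> B) : Prop :=
  boolean_morphism f /\
  forall p, bpa_filter p -> bpa_filter (f @` p `\ \bot).

Record partition_hom (A B : bpa) := PartitionHom {
  partition_hom_fun :> A -> B;
  partition_homP : partition_morphism partition_hom_fun }.

Lemma partition_hom_eq (A B : bpa) (f g : partition_hom A B) :
  (forall x, f x = g x) -> f = g.
Proof.
case: f g => [f fP] [g gP] /= /funext fg; rewrite fg in fP *.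
by rewrite (Prop_irrelevance fP gP).
Qed.

Fact partition_morphism_id (A : bpa) : @partition_morphism A A idfun.
Proof.
split=> // p Fp; rewrite image_id; have [[FP _ _ _] _] := bpaP A.
have [p0 _ _] := FP p Fp; suff -> : p `\ \bot = p by [].
by apply/seteqP; split=> [x []//|x px]; split=> // x0; apply: p0; rewrite -x0.
Qed.

Fact partition_morphism_comp (A B C : bpa)
    (f : partition_hom B C) (g : partition_hom A B) :
  @partition_morphism A C (f \o g).
Proof.
have [[f0 f1 fI fU fC] fF] := partition_homP f.
have [[g0 g1 gI gU gC] gF] := partition_homP g.
split=> [|p /gF/fF].
  by split=> [||x y|x y|x] /=; rewrite ?(g0, g1, gI, gU, gC).
congr (bpa_filter _); apply/seteqP; split=> z [].
  by move=> -[_ [[x px <-] _] <-] /= fx0; split=> //; exists x.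
move=> [x px <-] /= fx0; split=> //; exists (g x) => //; split; first by exists x.
by move=> /= gx0; apply: fx0; rewrite gx0 f0.
Qed.

Definition partition_hom_id (A : bpa) := PartitionHom (partition_morphism_id A).

Definition partition_hom_comp (A B C : bpa)
    (f : partition_hom B C) (g : partition_hom A B) :=
  PartitionHom (partition_morphism_comp f g).

Fact partition_hom_idl (A B : bpa) (f : partition_hom A B) :
  partition_hom_comp (partition_hom_id B) f = f.
Proof. exact: partition_hom_eq. Qed.

Fact partition_hom_idr (A B : bpa) (f : partition_hom A B) :
  partition_hom_comp f (partition_hom_id A) = f.
Proof. exact: partition_hom_eq. Qed.

Fact partition_hom_assoc (A B C D : bpa)
    (f : partition_hom C D) (g : partition_hom B C) (h : partition_hom A B) :
  partition_hom_comp f (partition_hom_comp g h) =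
  partition_hom_comp (partition_hom_comp f g) h.
Proof. exact: partition_hom_eq. Qed.

Definition bpa_category : category :=
  @Category bpa partition_hom partition_hom_id partition_hom_comp
    partition_hom_idl partition_hom_idr partition_hom_assoc.

Definition slr_bpa_category : category :=
  @full_subcategory bpa_category
    (fun B : bpa => subcomplete (@bpa_filter B) /\
                    locally_refinable (@bpa_filter B)).

Section Frames.
Context d (L : tbLatticeType d).

Definition complete_lattice : Prop :=
  forall S : set L, supremums S !=set0 /\ infimums S !=set0.

Definition is_frame : Prop :=
  complete_lattice /\
  forall (x : L) (S : set L) (s : L), supremums S s ->
    supremums [set Order.meet x y | y in S] (Order.meet x s).

Definition complemented (x : L) : Prop :=
  exists y : L, Order.meet x y = \bot /\ Order.join x y = \top.

Definition zero_dimensional : Prop :=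
  forall x : L, supremums [set y | complemented y /\ y <= x] x.

Definition is_cover (C : set L) : Prop := supremums C \top.

Definition ultraparacompact : Prop :=
  zero_dimensional /\
  forall C, is_cover C -> exists2 p, is_partition p & refines p C.

End Frames.

Record frame := Frame {
  frame_disp : Order.disp_t;
  frame_lattice :> tbLatticeType frame_disp;
  frameP : is_frame frame_lattice }.

Definition frame_morphism (L M : frame) (f : L -> M) : Prop :=
  [/\ f \top = \top, Order.meet_morphism f
    & forall (S : set L) (s : L), supremums S s -> supremums (f @` S) (f s)].

Record frame_hom (L M : frame) := FrameHom {
  frame_hom_fun :> L -> M;
  frame_homP : frame_morphism frame_hom_fun }.

Lemma frame_hom_eq (L M : frame) (f g : frame_hom L M) :
  (forall x, f x = g x) -> f = g.
Proof.
case: f g => [f fP] [g gP] /= /funext fg; rewrite fg in fP *.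
by rewrite (Prop_irrelevance fP gP).
Qed.

Fact frame_morphism_id (L : frame) : @frame_morphism L L idfun.
Proof. by split=> // S s; rewrite image_id. Qed.

Fact frame_morphism_comp (L M N : frame)
    (f : frame_hom M N) (g : frame_hom L M) : @frame_morphism L N (f \o g).
Proof.
have [f1 fI fS] := frame_homP f; have [g1 gI gS] := frame_homP g.
split=> [|x y|S s Ss] /=; rewrite ?g1 ?gI//.
by rewrite -image_comp; apply/fS/gS.
Qed.

Definition frame_hom_id (L : frame) := FrameHom (frame_morphism_id L).

Definition frame_hom_comp (L M N : frame)
    (f : frame_hom M N) (g : frame_hom L M) :=
  FrameHom (frame_morphism_comp f g).

Fact frame_hom_idl (A B : frame) (f : frame_hom A B) :
  frame_hom_comp (frame_hom_id B) f = f.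
Proof. exact: frame_hom_eq. Qed.

Fact frame_hom_idr (A B : frame) (f : frame_hom A B) :
  frame_hom_comp f (frame_hom_id A) = f.
Proof. exact: frame_hom_eq. Qed.

Fact frame_hom_assoc (A B C D : frame)
    (f : frame_hom C D) (g : frame_hom B C) (h : frame_hom A B) :
  frame_hom_comp f (frame_hom_comp g h) =
  frame_hom_comp (frame_hom_comp f g) h.
Proof. exact: frame_hom_eq. Qed.

Definition frame_category : category :=
  @Category frame frame_hom frame_hom_id frame_hom_comp
    frame_hom_idl frame_hom_idr frame_hom_assoc.

Definition ultraparacompact_frame_category : category :=
  @full_subcategory frame_category (fun L : frame => ultraparacompact L).

(* Main.v *)
From HB Require Import structures.
From mathcomp Require Import all_boot all_order.
From mathcomp Require Import boolp classical_sets.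
Require Import Defs.

(** An ultraparacompact frame is the same thing as a Boolean algebra together
    with the knowledge of which of its partitions have join 1 in the frame. To
    a frame [L] one attaches its Boolean algebra of complemented elements, the
    centre, and the filter of those families of complemented elements that
    partition [L]. A frame homomorphism preserves complements and joins, so it
    restricts to a partition homomorphism between centres. The resulting
    functor is shown to be fully faithful and essentially surjective; a
    quasi-inverse is then chosen ([equivalence_of_fully_faithful]).

    The centre is subcomplete because, in a frame, the join of part of a
    partition has the join of the rest as its complement
    ([subpartition_complement]); it is locally refinable because joins in a
    frame can be computed piecewise ([centre_locally_refinable]).

    The functor is faithful because complemented elements generate a
    zero-dimensional frame under joins. It is full because a partition
    homomorphism [phi] extends to all of [L] by sending [x] to the join of the
    [phi b] with [b <= x] complemented. That this extension preserves a join
    [s] of [S] is where ultraparacompactness enters: if [b <= s], the cover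
    made up of the complement of [b] together with all complemented elements
    that lie below a member of [S] is refined by a partition, and [phi] maps
    that partition to a partition ([extension_sup]).

    For essential surjectivity, a Boolean partition algebra [(B, F)] is
    represented by the frame of its local ideals: the downsets [I] containing
    0 such that [a] is in [I] as soon as [a] meets every block of some
    partition of [F] in an element of [I]. In other words, they are the ideals
    closed for the coverage whose covers are the partitions in [F]. Every
    element of [B] gives a principal ideal, which is complemented, and the
    central fact is [cover_refined]: any cover of the frame of local ideals is
    refined by a partition belonging to [F]. Local refinability is used there
    to glue partitions. From it follow ultraparacompactness, the fact that a
    family of elements of [B] whose principal ideals partition the frame
    belongs to [F], and, with subcompleteness, the fact that a complemented
    ideal is principal. So [B] is isomorphic, with its filter, to the centre
    of its frame of local ideals ([centre_representation]). *)

Set Implicit Arguments.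
Unset Strict Implicit.
Unset Printing Implicit Defensive.

Import Order.Theory.
Local Open Scope classical_set_scope.
Local Open Scope order_scope.

(** * Fully faithful and essentially surjective functors *)

(** The quasi-inverse sends [c] to a chosen [F0 c] with an isomorphism
    [e c : G (F0 c) -> c]; on morphisms it is conjugation by [e] followed by
    the unique lift along [G]. All equations hold because they hold after
    applying the faithful functor [G]. *)
Lemma equivalence_of_fully_faithful (C D : category) (G : functor D C) :
  (forall x y (f g : hom x y), fmap G f = fmap G g -> f = g) ->
  (forall x y (h : hom (G x) (G y)), exists f, fmap G f = h) ->
  (forall c : C, exists x (e : hom (G x) c), isomorphism e) ->
  equivalent_categories C D.
Proof.
move=> Ginj Gfull Gess.
pose F0 c := sval (cid (Gess c)).
pose e c : hom (G (F0 c)) c := sval (cid (svalP (cid (Gess c)))).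
have eP c : isomorphism (e c) := svalP (cid (svalP (cid (Gess c)))).
pose e' c : hom c (G (F0 c)) := sval (cid (eP c)).
have e'K c : comp (e' c) (e c) = idm _ by have [] := svalP (cid (eP c)).
have eK c : comp (e c) (e' c) = idm _ by have [] := svalP (cid (eP c)).
pose lift x y (h : hom (G x) (G y)) : hom x y := sval (cid (Gfull x y h)).
have liftK x y (h : hom (G x) (G y)) : fmap G (lift x y h) = h.
  exact: svalP (cid (Gfull x y h)).
pose F1 c c' (h : hom c c') := lift _ _ (comp (e' c') (comp h (e c))).
have F1id c : F1 c c (idm c) = idm (F0 c).
  by apply: Ginj; rewrite liftK fmap_id comp_idl e'K.
have F1comp x y z (f : hom y z) (g : hom x y) :
    F1 _ _ (comp f g) = comp (F1 _ _ f) (F1 _ _ g).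
  apply: Ginj; rewrite fmap_comp !liftK -!comp_assoc; congr comp.
  rewrite [in RHS]comp_assoc [in RHS]comp_assoc -(comp_assoc f) eK comp_idr.
  by rewrite comp_assoc.
pose F := Functor F1id F1comp.
exists F, G; split.
  exists e; split=> [x y f|//] /=.
  by rewrite liftK comp_assoc eK comp_idl.
exists (fun x => lift _ _ (e (G x))); split=> [x y f|x] /=.
  by apply: Ginj; rewrite !fmap_comp !liftK comp_assoc eK comp_idl.
exists (lift _ _ (e' (G x))); split; apply: Ginj;
  by rewrite fmap_comp !liftK fmap_id.
Qed.

(** * Joins and partitions in distributive settings *)

Section Sup.
Context d (L : tbLatticeType d).
Implicit Types (x y z : L) (S p : set L).

(** Frames satisfy this law, and so do Boolean algebras, where only some joins
    exist: both kinds of partitions are handled through it. *)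
Definition sup_distributive : Prop :=
  forall (x : L) (S : set L) (s : L), supremums S s ->
    supremums [set Order.meet x y | y in S] (Order.meet x s).

Definition complement_pair x y : Prop :=
  Order.meet x y = \bot /\ Order.join x y = \top.

Lemma sup_of2 x y : supremums [set x; y] (Order.join x y).
Proof.
split=> [_ [->|->]|z zub]; rewrite ?leUl ?leUr//.
by rewrite leUx !zub//; [right|left].
Qed.

(** That the join is the top element amounts to having no other upper bound. *)
Lemma is_partitionP p : is_partition p <->
  [/\ ~ p \bot,
      forall x y, p x -> p y -> x <> y -> Order.meet x y = \bot
    & forall z, ubound p z -> z = \top].
Proof.
split=> -[p0 pI p1]; split=> //.
  by move=> z zub; apply/eqP; rewrite -le1x; apply: (p1.2).
by split=> [x _|z /p1 ->]; rewrite lex1.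
Qed.

Hypothesis LD : sup_distributive.

(** To bound [x] it suffices to bound its traces on a family whose join lies
    above [x]; this is the form in which distributivity is used throughout. *)
Lemma le_sup S s x z : supremums S s -> x <= s ->
  (forall y, S y -> Order.meet x y <= z) -> x <= z.
Proof.
move=> Ss xs xz; move/meet_idPl: xs => <-; apply: (LD x Ss).2 => _ [y Sy <-].
exact: xz.
Qed.

Lemma le_by_complement x x' y z : Order.join x x' = \top ->
  Order.meet y x <= z -> Order.meet y x' <= z -> y <= z.
Proof.
move=> xx' yx yx'; apply: (le_sup (sup_of2 x x')); rewrite ?xx' ?lex1//.
by move=> _ [->|->].
Qed.

Lemma complement_pairI x x' y y' : complement_pair x x' ->
  complement_pair y y' ->
  complement_pair (Order.meet x y) (Order.join x' y').
Proof.
move=> [xx0 xx1] [yy0 yy1]; split; apply/eqP.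
  rewrite -lex0; apply: (le_sup (sup_of2 x' y')); first exact: leIr.
  move=> _ [->|->]; first by rewrite -xx0 leI2// leIxl// leIl.
  by rewrite -yy0 leI2// leIxl// leIr.
rewrite -le1x; apply: (le_by_complement xx1); rewrite meet1x.
  apply: (le_by_complement yy1); first exact: leUl.
  by rewrite leIxr// !lexUr.
by rewrite lexUr// leUl.
Qed.

Lemma complement_pair_sym x y : complement_pair x y -> complement_pair y x.
Proof. by rewrite /complement_pair meetC joinC. Qed.

Lemma complement_pair_partition x y : complement_pair x y ->
  is_partition ([set x; y] `\ \bot).
Proof.
move=> [xy0 xy1]; split; first by case=> _; apply.
  by move=> a b [[->|->] _] [[->|->] _] ab //; rewrite 1?meetC//; case: ab.
split=> [z _|z zub]; first exact: lex1.
have zP t : [set x; y] t -> t <= z.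
  by move=> tP; have [->|/eqP t0] := eqVneq t \bot; [exact: le0x|exact: zub].
by rewrite -xy1 leUx !zP//; [right|left].
Qed.

Lemma is_partition_meet p q : is_partition p -> is_partition q ->
  is_partition (partition_meet p q).
Proof.
move=> [_ pI p1] [_ qI q1]; apply/is_partitionP; split.
- by case=> _; apply.
- move=> _ _ [[x px [y qy <-]] _] [[x' px' [y' qy' <-]] _] ne.
  have [xx'|/eqP xx'] := eqVneq x x'; last first.
    by rewrite -meetACA (pI x x')// meet0x.
  have [yy'|/eqP yy'] := eqVneq y y'; first by case: ne; rewrite xx' yy'.
  by rewrite -meetACA (qI y y')// meetx0.
- move=> z zub; apply/eqP; rewrite -le1x.
  apply: (le_sup p1 (lexx _)) => x px; apply: (le_sup q1 (lex1 _)) => y qy.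
  rewrite meet1x; have [->|/eqP xy0] := eqVneq (Order.meet x y) \bot.
    exact: le0x.
  by apply: zub; split=> //; exists x => //; exists y.
Qed.

End Sup.

Lemma frame_distr (L : frame) : sup_distributive L.
Proof. exact: (frameP L).2. Qed.

(** Meeting with [x] is left adjoint to joining with the complement of [x], so
    it preserves every join that exists. *)
Lemma boolean_distr d (B : ctbDistrLatticeType d) : sup_distributive B.
Proof.
move=> x S s [sub slub]; split=> [_ [y Sy <-]|z zub].
  by rewrite leI2// sub.
suff : s <= Order.join (~` x) z by move=> /(leI2 (lexx x)) /le_trans; apply;
  rewrite meetUr meetxC join0x leIr.
apply: slub => y Sy; rewrite -[y]meet1x -(joinCx x) meetUl leU2 ?leIl//.
by apply: zub; exists y.
Qed.

Lemma compl_uniq d (B : ctbDistrLatticeType d) (x y : B) :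
  complement_pair x y -> y = ~` x.
Proof.
move=> [xy0 xy1]; apply/le_anti/andP; split.
  by rewrite -disj_leC meetC xy0.
apply: (le_by_complement (@boolean_distr _ B) xy1); rewrite ?leIr//.
by rewrite meetCx le0x.
Qed.

(** * Partitions of a frame and frame homomorphisms *)

Section FrameTheory.
Variable L : frame.
Implicit Types (S p : set L) (x y : L).

Definition fsup S : L := sval (cid ((frameP L).1 S).1).

Lemma fsupP S : supremums S (fsup S).
Proof. exact: svalP (cid ((frameP L).1 S).1). Qed.

Lemma fsup_ub S x : S x -> x <= fsup S.
Proof. exact: (fsupP S).1. Qed.

Lemma subpartition_complement p R : is_partition p -> R `<=` p ->
  complement_pair (fsup R) (fsup (p `\` R)).
Proof.
move=> [_ pI [_ p1]] Rp; split; apply/eqP.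
  rewrite -lex0; apply: (le_sup (@frame_distr L) (fsupP R) (leIl _ _)) => x Rx.
  apply: (le_sup (@frame_distr L) (fsupP (p `\` R))) => [|y [py Ry]].
    by rewrite leIxl// leIr.
  apply: (@le_trans _ _ (Order.meet x y)); first by rewrite leI2// leIr.
  by rewrite (pI x y)//; [exact: Rp|move=> xy; apply: Ry; rewrite -xy].
rewrite -le1x; apply: p1 => x px; have [Rx|Rx] := pselect (R x).
  by rewrite lexUl// fsup_ub.
by rewrite lexUr// fsup_ub.
Qed.

Lemma partition_complemented p x : is_partition p -> p x -> complemented x.
Proof.
move=> pP px; exists (fsup (p `\` [set x])).
have xE : fsup [set x] = x.
  apply: (@is_subset1_supremums _ _ [set x]); first exact: fsupP.
  by rewrite supremums1.
have := @subpartition_complement p [set x] pP; rewrite xE; apply.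
by move=> _ ->.
Qed.

End FrameTheory.

Section FrameHom.
Variables (L M : frame) (f : frame_hom L M).

Lemma frame_hom1 : f \top = \top.
Proof. by case: (frame_homP f). Qed.

Lemma frame_homI : Order.meet_morphism f.
Proof. by case: (frame_homP f). Qed.

Lemma frame_hom_sup S s : supremums S s -> supremums (f @` S) (f s).
Proof. by case: (frame_homP f) => _ _; apply. Qed.

Lemma frame_hom0 : f \bot = \bot.
Proof.
apply/eqP; rewrite -lex0; have [|_] := @frame_hom_sup set0 \bot.
  by split=> // z _; exact: le0x.
by apply; rewrite image_set0.
Qed.

Lemma frame_homU : Order.join_morphism f.
Proof.
move=> x y; apply: is_subset1_supremums (frame_hom_sup (sup_of2 x y)) _.
rewrite image_setU !image_set1; exact: sup_of2.
Qed.

Lemma frame_hom_partition p : is_partition p -> is_partition ((f @` p) `\ \bot).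
Proof.
move=> [_ pI /frame_hom_sup [_ p1]]; apply/is_partitionP; split.
- by case=> _; apply.
- move=> _ _ [[x px <-] _] [[y py <-] _] fxy.
  by rewrite -frame_homI pI ?frame_hom0// => xy; apply: fxy; rewrite xy.
- move=> z zub; apply/eqP; rewrite -le1x -frame_hom1; apply: p1 => _ [x px <-].
  have [->|/eqP fx0] := eqVneq (f x) \bot; first exact: le0x.
  by apply: zub; split=> //; exists x.
Qed.

End FrameHom.

(** * The Boolean partition algebra of complemented elements *)

Record centre (L : frame) := Centre {
  centre_val :> L;
  centre_val_in : `[< complemented centre_val >] }.

HB.instance Definition _ (L : frame) := [isSub of centre L for @centre_val L].
HB.instance Definition _ (L : frame) := [Choice of centre L by <:].

Section Centre.
Variable L : frame.
Notation compl_pred := (fun x : L => `[< complemented x >]).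

Fact complemented_meet_closed : meet_closed compl_pred.
Proof.
move=> x y /asboolP[x' xx'] /asboolP[y' yy']; apply/asboolP.
by exists (Order.join x' y'); exact: (complement_pairI (@frame_distr L)).
Qed.

Fact complemented_join_closed : join_closed compl_pred.
Proof.
move=> x y /asboolP[x' xx'] /asboolP[y' yy']; apply/asboolP.
exists (Order.meet x' y'); apply/complement_pair_sym.
by apply: (complement_pairI (@frame_distr L)); exact: complement_pair_sym.
Qed.

Fact complemented0 : \bot \in compl_pred.
Proof. by apply/asboolP; exists \top; rewrite meet0x joinx1. Qed.

Fact complemented1 : \top \in compl_pred.
Proof. by apply/asboolP; exists \bot; rewrite meetx0 join1x. Qed.

HB.instance Definition _ := Order.SubChoice_isTBSubLattice.Build
  (frame_disp L) L compl_pred (frame_disp L) (centre L)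
  complemented_meet_closed complemented_join_closed complemented0 complemented1.

Lemma centre_inj (x y : centre L) : x = y :> L -> x = y.
Proof. exact: val_inj. Qed.

Lemma centre_le (x y : centre L) : (x <= y) = ((x : L) <= (y : L)).
Proof. by rewrite -Order.le_val. Qed.

Lemma centre_meet (x y : centre L) :
  Order.meet x y = Order.meet (x : L) (y : L) :> L.
Proof. by []. Qed.

Lemma centre_join (x y : centre L) :
  Order.join x y = Order.join (x : L) (y : L) :> L.
Proof. by []. Qed.

Lemma centre0 : ((\bot : centre L) : L) = \bot.
Proof. by []. Qed.

Lemma centre1 : ((\top : centre L) : L) = \top.
Proof. by []. Qed.

Fact centre_meetUl :
  @left_distributive (centre L) (centre L) Order.meet Order.join.
Proof.
move=> x y z; apply/le_anti/andP; split; last first.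
  by rewrite leUx !leI2// ?leUl// leUr.
rewrite centre_le !(centre_meet, centre_join).
apply: (le_sup (@frame_distr L) (sup_of2 (x : L) (y : L)) (leIl _ _)).
move=> _ [->|->].
  by rewrite lexUl// meetC leI2// leIr.
by rewrite lexUr// meetC leI2// leIr.
Qed.

HB.instance Definition _ := Order.Lattice_Meet_isDistrLattice.Build
  (frame_disp L) (centre L) centre_meetUl.

Lemma centre_complement_pair (x y : centre L) :
  complement_pair (x : L) (y : L) <-> complement_pair x y.
Proof.
split=> -[xy0 xy1]; split.
- by apply: centre_inj; rewrite centre_meet xy0 centre0.
- by apply: centre_inj; rewrite centre_join xy1 centre1.
- by rewrite -centre_meet xy0 centre0.
- by rewrite -centre_join xy1 centre1.
Qed.

Lemma ex_centre_compl (x : centre L) : exists y, complement_pair x y.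
Proof.
have /asboolP[y xy] := centre_val_in x.
have yP : `[< complemented y >].
  by apply/asboolP; exists x; exact: complement_pair_sym.
by exists (Centre yP); exact/centre_complement_pair.
Qed.

Definition centre_compl x := sval (cid (ex_centre_compl x)).

Fact centre_joinxC x : Order.join x (centre_compl x) = \top.
Proof. exact: (svalP (cid (ex_centre_compl x))).2. Qed.

Fact centre_meetxC x : Order.meet x (centre_compl x) = \bot.
Proof. exact: (svalP (cid (ex_centre_compl x))).1. Qed.

HB.instance Definition _ := Order.TBDistrLattice_hasComplement.Build
  (frame_disp L) (centre L) centre_joinxC centre_meetxC.

Lemma centre_complP (x : centre L) :
  complement_pair (x : L) ((~` x : centre L) : L).
Proof. by apply/centre_complement_pair; split; rewrite ?meetxC ?joinxC. Qed.

(** The join is required to be the top element in [L], which is stronger than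
    in the centre: an upper bound in [L] need not be complemented. *)
Definition centre_filter : set (set (centre L)) :=
  [set p | is_partition (@centre_val L @` p)].

Lemma centre_filterP p : centre_filter p <->
  [/\ ~ p \bot,
      forall x y, p x -> p y -> x <> y -> Order.meet x y = \bot
    & forall z : L, (forall x : centre L, p x -> (x : L) <= z) -> z = \top].
Proof.
split=> [/is_partitionP|] [p0 pI p1].
  split=> [p0'|x y px py xy|z zub].
  - by apply: p0; exists \bot => //; exact: centre0.
  - apply: centre_inj; rewrite centre_meet centre0.
    by apply: pI; [exists x|exists y|move/centre_inj].
  - by apply: p1 => _ [x px <-]; exact: zub.
apply/is_partitionP; split.
- by move=> [x px]; rewrite -centre0 => /centre_inj x0; apply: p0; rewrite -x0.
- move=> _ _ [x px <-] [y py <-] xy.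
  by rewrite -centre_meet pI ?centre0// => xyE; apply: xy; rewrite xyE.
- by move=> z zub; apply: p1 => x px; apply: zub; exists x.
Qed.

Lemma centre_filter_sub : centre_filter `<=` @is_partition _ (centre L).
Proof.
move=> p /centre_filterP[p0 pI p1]; apply/is_partitionP; split=> // z zub.
by apply: centre_inj; rewrite centre1; apply: p1 => x /zub; rewrite centre_le.
Qed.

Lemma image_centreD0 (A : set (centre L)) :
  @centre_val L @` (A `\ \bot) = (@centre_val L @` A) `\ \bot.
Proof.
apply/seteqP; split=> [_ [x [Ax x0] <-]|_ [[x Ax <-] x0]].
  split; first by exists x.
  by rewrite /= -centre0 => /centre_inj.
by exists x => //; split=> // xE; apply: x0; rewrite xE -centre0.
Qed.

Lemma centre_filter_compl x : centre_filter ([set x; ~` x] `\ \bot).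
Proof.
rewrite /centre_filter /= image_centreD0 image_setU !image_set1.
exact/complement_pair_partition/centre_complP.
Qed.

Lemma centre_bpa : is_bpa centre_filter.
Proof.
split; last first.
  apply/seteqP; split=> // x _.
  have [->|/eqP x0] := eqVneq x \bot; first by left.
  right; exists ([set x; ~` x] `\ \bot); first exact: centre_filter_compl.
  by split=> //; left.
split; first exact: centre_filter_sub.
- by exists ([set \top; ~` \top] `\ \bot); exact: centre_filter_compl.
- move=> p q /centre_filterP[_ _ p1] /is_partitionP[q0 qI _] pq.
  apply/centre_filterP; split=> // z zub; apply: p1 => x /pq [y qy].
  by rewrite centre_le => /le_trans; apply; exact: zub.
- move=> p q Fp Fq; rewrite /centre_filter /=.
  suff -> : @centre_val L @` partition_meet p q =
            partition_meet (@centre_val L @` p) (@centre_val L @` q).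
    exact: (is_partition_meet (@frame_distr L)).
  rewrite image_centreD0; congr (_ `\ _); apply/seteqP; split=> z.
    move=> [_ [x px [y qy <-]] <-]; rewrite centre_meet.
    by exists (x : L); [exists x|exists (y : L) => //; exists y].
  move=> [_ [x px <-] [_ [y qy <-] <-]].
  by exists (Order.meet x y); rewrite ?centre_meet//; exists x => //; exists y.
Qed.

Lemma centre_sup (R : set (centre L)) (s : centre L) :
  supremums (@centre_val L @` R) (s : L) -> supremums R s.
Proof.
move=> [sub slub]; split=> [x Rx|z zub]; rewrite centre_le.
  by apply: sub; exists x.
by apply: slub => _ [x Rx <-]; rewrite -centre_le; exact: zub.
Qed.

Lemma centre_subcomplete : subcomplete centre_filter.
Proof.
move=> p Fp R Rp.
have sP := subpartition_complement Fp (image_subset Rp).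
have sC : `[< complemented (fsup (@centre_val L @` R)) >].
  by apply/asboolP; eexists; exact: sP.
by exists (Centre sC); apply: centre_sup; exact: fsupP.
Qed.

(** If [z] bounds all the pieces [P a], then it bounds each [a], since with
    the complement of [a] it bounds a partition of [L]; hence [z] is the top
    element. *)
Lemma centre_locally_refinable : locally_refinable centre_filter.
Proof.
move=> p P /centre_filterP[_ pI p1] _ PP; apply/centre_filterP; split.
- by move=> [a pa]; have [[P0 _ _] _] := PP a pa.
- move=> x y [a pa Pax] [b pb Pby] xy.
  have [[_ PaI [aub _]] _] := PP a pa; have [[_ _ [bub _]] _] := PP b pb.
  have [ab|/eqP ab] := eqVneq a b; first by apply: PaI => //; rewrite ab.
  by apply/eqP; rewrite -lex0 -(pI a b pa pb ab) leI2// ?aub ?bub.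
- move=> z zub; apply: p1 => a pa.
  have [_ /centre_filterP[_ _ Pa1]] := PP a pa.
  have [aI _] := centre_complP a.
  have zC : Order.join z ((~` a : centre L) : L) = \top.
    apply: Pa1 => x [->|Pax]; first exact: leUr.
    by rewrite lexUl// zub//; exists a.
  by apply: (le_by_complement (@frame_distr L) zC); rewrite ?leIr ?aI ?le0x.
Qed.

End Centre.

(** * The centre as a functor *)

Section CentreMap.
Variables (L M : frame) (f : frame_hom L M).

Fact centre_map_in (x : centre L) : `[< complemented (f x) >].
Proof.
have /asboolP[y [xy0 xy1]] := centre_val_in x; apply/asboolP; exists (f y).
by rewrite -frame_homI -frame_homU xy0 xy1 frame_hom0 frame_hom1.
Qed.

Definition centre_map x : centre M := Centre (centre_map_in x).

Fact centre_map_boolean : boolean_morphism centre_map.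
Proof.
have mI : Order.meet_morphism centre_map.
  by move=> x y; apply: centre_inj; rewrite centre_meet; exact: frame_homI.
have mU : Order.join_morphism centre_map.
  by move=> x y; apply: centre_inj; rewrite centre_join; exact: frame_homU.
have m0 : centre_map \bot = \bot.
  by apply: centre_inj; rewrite centre0; exact: frame_hom0.
have m1 : centre_map \top = \top.
  by apply: centre_inj; rewrite centre1; exact: frame_hom1.
split=> // x; apply: compl_uniq.
by split; rewrite -?mI -?mU ?meetxC ?joinxC.
Qed.

Fact centre_map_filter (p : set (centre L)) : centre_filter p ->
  centre_filter ((centre_map @` p) `\ \bot).
Proof.
move=> pF; suff E : @centre_val M @` ((centre_map @` p) `\ \bot) =
    (f @` (@centre_val L @` p)) `\ \bot.
  by rewrite /centre_filter /mkset E; exact: frame_hom_partition.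
rewrite image_centreD0; congr (_ `\ _); apply/seteqP; split.
  by move=> _ [_ [x px <-] <-]; exists (x : L) => //; exists x.
by move=> _ [_ [x px <-] <-]; exists (centre_map x) => //; exists x.
Qed.

End CentreMap.

Definition centre_bpa_of (L : frame) : bpa := Bpa (@centre_bpa L).

Definition centre_hom (L M : frame) (f : frame_hom L M) :
  partition_hom (centre_bpa_of L) (centre_bpa_of M) :=
  @PartitionHom (centre_bpa_of L) (centre_bpa_of M) (centre_map f)
    (conj (centre_map_boolean f) (@centre_map_filter L M f)).

Definition centre_slr (L : ultraparacompact_frame_category) :
    slr_bpa_category :=
  exist (fun B : bpa => subcomplete (@bpa_filter B) /\
                    locally_refinable (@bpa_filter B))
    (centre_bpa_of (sval L))
    (conj (@centre_subcomplete (sval L)) (@centre_locally_refinable (sval L))).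

Fact centre_hom_id (L : ultraparacompact_frame_category) :
  centre_hom (frame_hom_id (sval L)) = idm (centre_slr L).
Proof. by apply: partition_hom_eq => x; exact: centre_inj. Qed.

Fact centre_hom_comp (L M N : frame) (f : frame_hom M N) (g : frame_hom L M) :
  centre_hom (frame_hom_comp f g) =
  partition_hom_comp (centre_hom f) (centre_hom g).
Proof. by apply: partition_hom_eq => x; exact: centre_inj. Qed.

Definition centre_functor :
    functor ultraparacompact_frame_category slr_bpa_category :=
  @Functor ultraparacompact_frame_category slr_bpa_category centre_slr
    (fun L M f => centre_hom f) centre_hom_id
    (fun L M N f g => centre_hom_comp f g).

Lemma centre_hom_inj (L M : frame) (f g : frame_hom L M) :
  zero_dimensional L -> centre_hom f = centre_hom g -> f = g.
Proof.
move=> zL fg; apply: frame_hom_eq => x.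
apply: is_subset1_supremums (frame_hom_sup f (zL x)) _.
rewrite (_ : f @` _ = g @` [set y | complemented y /\ y <= x]).
  exact: frame_hom_sup (zL x).
apply: eq_imagel => y [/asboolP yC _].
exact: (congr1 (fun h : partition_hom (centre_bpa_of L) (centre_bpa_of M) =>
  centre_val (h (Centre yC))) fg).
Qed.

(** * Extending a partition homomorphism to the frame *)

Section Extension.
Variables (L M : frame).
Variable phi : partition_hom (centre_bpa_of L) (centre_bpa_of M).
Hypothesis LU : ultraparacompact L.

Let ph (b : centre L) : centre M := phi b.

Let phI : Order.meet_morphism ph.
Proof. by case: (partition_homP phi) => -[]. Qed.
Let ph0 : ph \bot = \bot.
Proof. by case: (partition_homP phi) => -[]. Qed.
Let ph1 : ph \top = \top.
Proof. by case: (partition_homP phi) => -[]. Qed.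
Let phF p : centre_filter p -> centre_filter ((ph @` p) `\ \bot).
Proof. by case: (partition_homP phi) => _; apply. Qed.
Let ph_mono (b c : centre L) : b <= c -> ph b <= ph c.
Proof. by move=> /meet_idPl <-; rewrite phI leIr. Qed.

Definition extension (x : L) : M :=
  fsup [set centre_val (phi b) | b in [set b : centre L | (b : L) <= x]].

Let le_ext (b : centre L) x : (b : L) <= x -> (ph b : M) <= extension x.
Proof. by move=> bx; apply: fsup_ub; exists b. Qed.

Let ext_le x z : (forall b : centre L, (b : L) <= x -> (ph b : M) <= z) ->
  extension x <= z.
Proof. by move=> xz; apply: (fsupP _).2 => _ [b bx <-]; exact: xz. Qed.

Let meet_ext_le x y z : y <= extension x ->
  (forall b : centre L, (b : L) <= x -> Order.meet y (ph b : M) <= z) -> y <= z.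
Proof.
move=> yx xz; apply: (le_sup (@frame_distr M) (fsupP _) yx) => _ [b bx <-].
exact: xz.
Qed.

Let ext_mono x y : x <= y -> extension x <= extension y.
Proof. by move=> xy; apply: ext_le => b /le_trans/(_ xy)/le_ext. Qed.

Lemma extension_centre (b : centre L) : extension b = ph b.
Proof.
apply/le_anti/andP; split; last exact: le_ext.
by apply: ext_le => c; rewrite -!centre_le; exact: ph_mono.
Qed.

Fact extension1 : extension \top = \top.
Proof. by rewrite -[X in extension X]centre1 extension_centre ph1 centre1. Qed.

(** The two joins defining [extension x] and [extension y] are distributed
    over each other, and [phi] preserves the meets of complemented elements. *)
Fact extensionI : Order.meet_morphism extension.
Proof.
move=> x y; apply/le_anti/andP; split.
  by rewrite lexI !ext_mono ?leIl ?leIr.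
apply: (meet_ext_le (leIl _ _)) => b bx.
apply: (meet_ext_le (x := y)) => [|c cy].
  by rewrite leIxl// leIr.
apply: (@le_trans _ _ (Order.meet (ph b : M) (ph c : M))).
  by rewrite leI2// leIr.
by rewrite -centre_meet -phI le_ext// centre_meet leI2.
Qed.

(** The point is that [phi b] lies below any upper bound of the images of [S]
    when [b] lies below the join of [S]. A partition refining the cover [C]
    cuts [phi b] into pieces, each of which is either 0, when its block is
    disjoint from [b], or below the image of a member of [S]. *)
Fact extension_sup S s :
  supremums S s -> supremums (extension @` S) (extension s).
Proof.
move=> [sub slub]; split=> [_ [x Sx <-]|z zub]; first exact/ext_mono/sub.
apply: ext_le => b bs.
pose C := (~` b : L) |` [set c : L | complemented c /\ exists2 x, S x & c <= x].
have Ccov : is_cover C.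
  split=> [x _|y yub]; first exact: lex1.
  have [_ <-] := centre_complP b; rewrite leUx; apply/andP; split.
    apply: (le_trans bs); apply: slub => x Sx; apply: (LU.1 x).2 => c [cC cx].
    by apply: yub; right; split=> //; exists x.
  by apply: yub; left.
have [p pP pC] := LU.2 C Ccov.
pose q := [set c : centre L | p c].
have qF : centre_filter q.
  suff -> : centre_filter q = is_partition p by [].
  congr is_partition; apply/seteqP; split=> [_ [c qc <-]//|c pc].
  have /asboolP cC := partition_complemented pP pc.
  by exists (Centre cC).
have [_ _ q1] := phF qF.
apply: (le_sup (@frame_distr M) q1 (lex1 _)) => _ [_ [[c qc <-] _] <-].
rewrite -centre_meet -phI.
have [t [->|[_ [x Sx tx]]] ct] := pC (centre_val c) qc.
  suff -> : Order.meet b c = \bot by rewrite ph0 centre0 le0x.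
  by apply/eqP; rewrite -lex0 -(meetxC b) leI2.
apply: le_trans (_ : extension x <= z); last by apply: zub; exists x.
apply: le_ext; rewrite centre_meet leIxr//; exact: le_trans tx.
Qed.

Definition extension_hom : frame_hom L M :=
  FrameHom (And3 extension1 extensionI extension_sup).

Lemma extension_homK : centre_hom extension_hom = phi.
Proof.
by apply: partition_hom_eq => b; apply: centre_inj; exact: extension_centre.
Qed.

End Extension.

(** * The frame of local ideals *)

(** Ideals closed under the joins of subfamilies of partitions in [F],
    expressed without joins: the pieces [Order.meet a c] of [a] form, up to 0,
    part of a partition of [F], and their join is [a]. In this form, as a
    sheaf-like gluing condition, it makes the local ideals a frame for any [F]
    at all. *)
Definition is_local_ideal d (B : ctbDistrLatticeType d) (F : set (set B))
    (I : set B) : Prop :=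
  [/\ I \bot,
      forall a b, b <= a -> I a -> I b
    & forall a p, F p -> (forall c, p c -> I (Order.meet a c)) -> I a].

Record local_ideal d (B : ctbDistrLatticeType d) (F : set (set B)) :=
  LocalIdeal {
    ideal_set :> B -> Prop;
    local_idealP : is_local_ideal F ideal_set }.

Section LocalIdealLattice.
Context d (B : ctbDistrLatticeType d) (F : set (set B)).
Notation ideal := (local_ideal F).
Implicit Types (I J K : ideal) (a b c : B).

Lemma local_ideal_eq I J : ideal_set I = J -> I = J.
Proof.
case: I J => [I IP] [J JP] /= IJ; rewrite IJ in IP *.
by rewrite (Prop_irrelevance IP JP).
Qed.

Lemma ideal0 I : I \bot.
Proof. by case: (local_idealP I). Qed.

Lemma ideal_down I a b : b <= a -> I a -> I b.
Proof. by case: (local_idealP I) => _ h _; exact: h. Qed.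

Lemma ideal_local I a p : F p -> (forall c, p c -> I (Order.meet a c)) -> I a.
Proof. by case: (local_idealP I) => _ _; apply. Qed.

HB.instance Definition _ := gen_eqMixin ideal.
HB.instance Definition _ := gen_choiceMixin ideal.

Definition ideal_le I J : bool := `[< ideal_set I `<=` ideal_set J >].

Fact ideal_le_refl : reflexive ideal_le.
Proof. by move=> I; apply/asboolP. Qed.

Fact ideal_le_anti : antisymmetric ideal_le.
Proof.
move=> I J /andP[/asboolP IJ /asboolP JI].
by apply: local_ideal_eq; apply/seteqP.
Qed.

Fact ideal_le_trans : transitive ideal_le.
Proof.
move=> J I K /asboolP IJ /asboolP JK; apply/asboolP; exact: subset_trans JK.
Qed.

HB.instance Definition _ := Order.Le_isPOrder.Build d ideal
  ideal_le_refl ideal_le_anti ideal_le_trans.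

Lemma ideal_leP I J : reflect (ideal_set I `<=` ideal_set J) (I <= J).
Proof. exact: asboolP. Qed.

Fact ideal_meet_subproof I J :
  is_local_ideal F (ideal_set I `&` ideal_set J)%classic.
Proof.
split=> [|a b ba [Ia Ja]|a p Fp pK]; first by split; exact: ideal0.
- by split; apply: ideal_down ba _.
- by split; apply: ideal_local Fp _ => c /pK [].
Qed.

Definition ideal_meet I J : ideal := LocalIdeal (ideal_meet_subproof I J).

Fact ideal_full_subproof : is_local_ideal F [set: B].
Proof. by []. Qed.

Definition ideal_full : ideal := LocalIdeal ideal_full_subproof.

Fact ideal_span_subproof (S : set B) :
  is_local_ideal F [set a | forall I, S `<=` ideal_set I -> I a].
Proof.
split=> [I _|a b ba Ka I SI|a p Fp pK I SI]; first exact: ideal0.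
- exact: ideal_down ba (Ka I SI).
- by apply: ideal_local Fp _ => c /pK /(_ I SI).
Qed.

Definition ideal_span S : ideal := LocalIdeal (ideal_span_subproof S).

Lemma ideal_span_le S I : ideal_span S <= I <-> S `<=` ideal_set I.
Proof.
split=> [/ideal_leP SI a Sa|SI]; first by apply: SI => J; apply.
by apply/ideal_leP => a; apply.
Qed.

Fact ideal_meetP I J K : (I <= ideal_meet J K) = (I <= J) && (I <= K).
Proof.
apply/ideal_leP/andP => [IJK|[/ideal_leP IJ /ideal_leP IK] a Ia].
  by split; apply/ideal_leP => a /IJK [].
by split; [exact: IJ|exact: IK].
Qed.

Fact ideal_joinP I J K :
  (ideal_span (ideal_set I `|` ideal_set J)%classic <= K) =
  (I <= K) && (J <= K).
Proof.
apply/idP/andP => [/ideal_span_le IJK|[/ideal_leP IK /ideal_leP JK]].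
  by split; apply/ideal_leP => a aP; apply: IJK; [left|right].
by apply/ideal_span_le => a [/IK|/JK].
Qed.

HB.instance Definition _ := Order.POrder_MeetJoin_isLattice.Build d ideal
  ideal_meetP ideal_joinP.

Fact ideal_le0 I : ideal_span set0 <= I.
Proof. by apply/ideal_span_le. Qed.

Fact ideal_le1 I : I <= ideal_full.
Proof. by apply/ideal_leP. Qed.

HB.instance Definition _ := Order.hasBottom.Build d ideal ideal_le0.
HB.instance Definition _ := Order.hasTop.Build d ideal ideal_le1.

Lemma ideal_sup (S : set ideal) :
  supremums S (ideal_span (\bigcup_(I in S) ideal_set I)).
Proof.
split=> [I SI|K Kub].
  by apply/ideal_leP => a Ia J; apply; exists I.
by apply/ideal_span_le => a [I SI Ia]; move/ideal_leP: (Kub I SI); exact.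
Qed.

Fact ideal_imp_subproof I J :
  is_local_ideal F [set a | forall b, I b -> J (Order.meet a b)].
Proof.
split=> [b _|a b ba Ka c /Ka|a p Fp pK b Ib].
- by rewrite meet0x; exact: ideal0.
- by apply: ideal_down; rewrite leI2.
- by apply: ideal_local Fp _ => c /pK /(_ b Ib); rewrite meetAC.
Qed.

Definition ideal_imp I J : ideal := LocalIdeal (ideal_imp_subproof I J).

(** Meeting with [I] has a right adjoint, which is why it preserves joins. *)
Lemma ideal_impP I J K : (Order.meet K I <= J) = (K <= ideal_imp I J).
Proof.
apply/ideal_leP/ideal_leP => [KIJ a Ka b Ib|KIJ a [Ka Ia]].
  by apply: KIJ; split; [apply: ideal_down Ka|apply: ideal_down Ib];
    rewrite ?leIl ?leIr.
by have := KIJ a Ka a Ia; rewrite meetxx.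
Qed.

Lemma ideal_frame : is_frame ideal.
Proof.
split=> [S|I S s [sub slub]].
  split; first by eexists; exact: ideal_sup.
  exists (ideal_span [set a | forall I, S I -> I a]); split=> [I SI|K Klb].
    by apply/ideal_span_le => a; apply.
  apply/ideal_leP => a Ka J; apply => I SI.
  by move/ideal_leP: (Klb I SI); exact.
split=> [_ [J SJ <-]|K Kub]; first by rewrite leI2// sub.
rewrite meetC ideal_impP; apply: slub => J SJ.
by rewrite -ideal_impP meetC; apply: Kub; exists J.
Qed.

Definition ideal_frame_of : frame := Frame ideal_frame.

End LocalIdealLattice.

(** * Local ideals of a Boolean partition algebra *)

Section LocalIdealBpa.
Context d (B : ctbDistrLatticeType d) (F : set (set B)).
Hypothesis BF : is_bpa F.
Notation ideal := (local_ideal F).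
Implicit Types (I J K : ideal) (a b c : B) (p : set B).

Let FP p : F p -> is_partition p.
Proof. by case: BF => -[FP _ _ _] _; exact: FP. Qed.

Let le_part p a b : F p -> (forall c, p c -> Order.meet a c <= b) -> a <= b.
Proof.
by move=> /FP [_ _ p1]; exact: (le_sup (@boolean_distr _ B) p1 (lex1 a)).
Qed.

(** Any partition of [F] having [b] as a block refines the two-block one, all
    its other blocks being disjoint from [b]; if [b] is 0, any partition of [F]
    does. *)
Lemma bpa_compl b : F ([set b; ~` b] `\ \bot).
Proof.
have [[_ [p0 Fp0] Fup _] Bcov] := BF.
have pP : is_partition ([set b; ~` b] `\ \bot).
  by apply: complement_pair_partition; split; rewrite ?meetxC ?joinxC.
have [b0|/eqP b0] := eqVneq b \bot.
  apply: (Fup _ _ Fp0 pP) => r pr.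
  exists (~` b); last by rewrite b0 compl0 lex1.
  split; first by right.
  rewrite b0 compl0 => /= t0; have [p00 _ _] := FP Fp0; apply: p00.
  suff -> : \bot = r by [].
  by apply/le_anti/andP; rewrite le0x -t0 lex1.
have : [set: B] b by [].
rewrite Bcov => -[//|[p Fp pb]]; have [p0' pI _] := FP Fp.
apply: (Fup _ _ Fp pP) => r pr.
have r0 : r <> \bot by move=> r0; apply: p0'; rewrite -r0.
have [->|/eqP rb] := eqVneq r b; first by exists b => //; split=> //; left.
have rC : r <= ~` b by rewrite -disj_leC pI.
exists (~` b) => //; split; first by right.
by move=> bC; apply: r0; apply/eqP; rewrite -lex0 -bC.
Qed.

Fact principal_subproof b : is_local_ideal F [set a | a <= b].
Proof.
split=> [|x y|x p Fp]; [exact: le0x|exact: le_trans|exact: le_part].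
Qed.

Definition principal b : ideal := LocalIdeal (principal_subproof b).

Lemma principal_le b I : principal b <= I <-> I b.
Proof.
split=> [/ideal_leP/(_ b)|Ib]; first by apply; exact: lexx.
by apply/ideal_leP => a ab; exact: ideal_down ab Ib.
Qed.

Lemma principal_mono a b : (principal a <= principal b) = (a <= b).
Proof. by apply/idP/idP => [/principal_le|ab]; last exact/principal_le. Qed.

Lemma principal_inj : injective principal.
Proof.
by move=> a b ab; apply/le_anti/andP; rewrite -!principal_mono ab lexx.
Qed.

Lemma principal0 : principal \bot = \bot.
Proof.
by apply/eqP; rewrite -lex0; apply/principal_le; exact: ideal0.
Qed.

Lemma principal1 : principal \top = \top.
Proof. by apply/eqP; rewrite -le1x; apply/ideal_leP => a _; exact: lex1. Qed.

Lemma in_ideal_bot b : (\bot : ideal) b -> b = \bot.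
Proof.
by move=> /principal_le; rewrite -principal0 principal_mono lex0 => /eqP.
Qed.

Lemma principalI : Order.meet_morphism principal.
Proof.
move=> a b; apply/le_anti/andP; split.
  by rewrite lexI !principal_mono leIl leIr.
by apply/ideal_leP => c [ca cb]; rewrite /= lexI; apply/andP.
Qed.

Lemma ideal_eq_top I : I \top -> I = \top.
Proof.
by move=> IT; apply/eqP; rewrite -le1x -principal1; apply/principal_le.
Qed.

Lemma principalC b : complement_pair (principal b) (principal (~` b)).
Proof.
split; first by rewrite -principalI meetxC principal0.
apply: ideal_eq_top; apply: (ideal_local (bpa_compl b)) => c [cb _].
rewrite meet1x; apply/principal_le.
by case: cb => ->; [exact: leUl|exact: leUr].
Qed.

Lemma principal_complemented b : complemented (principal b).
Proof. by exists (principal (~` b)); exact: principalC. Qed.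

Lemma ideal_zero_dimensional : zero_dimensional ideal.
Proof.
move=> I; split=> [J []//|K Kub]; apply/ideal_leP => a Ia.
apply/principal_le; apply: Kub; split; first exact: principal_complemented.
exact/principal_le.
Qed.

Lemma principal_partition p : F p -> is_partition (principal @` p).
Proof.
move=> Fp; have [p0 pI _] := FP Fp; apply/is_partitionP; split.
- move=> [b pb]; rewrite -principal0 => /principal_inj b0.
  by apply: p0; rewrite -b0.
- move=> _ _ [a pa <-] [b pb <-] ab.
  by rewrite -principalI pI ?principal0// => abE; apply: ab; rewrite abE.
- move=> I Iub; apply: ideal_eq_top; apply: (ideal_local Fp) => c pc.
  by rewrite meet1x; apply/principal_le; apply: Iub; exists c.
Qed.

Hypothesis BR : locally_refinable F.

(** Local refinability, in the form that serves for gluing: cutting each block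
    [c] of a partition of [F] along its own partition [Q c] of [F] yields a
    partition of [F]. A partition with at most one block is empty or
    consists of the top element, and these cases are immediate. *)
Lemma locally_refined_partition p (Q : B -> set B) :
  F p -> (forall c, p c -> F (Q c)) ->
  F (\bigcup_(c in p) ([set Order.meet c e | e in Q c] `\ \bot)).
Proof.
move=> Fp FQ; have [[_ _ Fup FI] _] := BF; have [p0 pI [_ p1]] := FP Fp.
have [p2|p2] := pselect (exists a b, [/\ p a, p b & a <> b]); last first.
  have [pE|/set0P[t pt]] := eqVneq p set0; first by rewrite pE bigcup_set0 -pE.
  have pE c : p c -> c = t.
    by move=> pc; apply: contrapT => ct; case: p2; exists c, t.
  have tT : t = \top by apply/eqP; rewrite -le1x; apply: p1 => c /pE ->.
  suff -> : \bigcup_(c in p) ([set Order.meet c e | e in Q c] `\ \bot) = Q t.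
    exact: FQ.
  have [q0 _ _] := FP (FQ t pt); apply/seteqP; split.
    by move=> _ [c /pE -> [[e Qe <-] _]]; rewrite tT meet1x -tT.
  move=> e Qe; exists t => //; split; last by move=> e0; apply: q0; rewrite -e0.
  by exists e => //; rewrite tT meet1x.
pose P c := [set Order.meet c e | e in Q c] `\ \bot.
have PP c : p c -> partition_of c (P c).
  move=> pc; have [_ QI Q1] := FP (FQ c pc); split.
  - by case=> _; apply.
  - move=> _ _ [[e Qe <-] _] [[e' Qe' <-] _] ne.
    rewrite -meetACA (QI e e')//; first by rewrite meetx0.
    by move=> ee'; apply: ne; rewrite ee'.
  - split=> [_ [[e Qe <-] _]|z zub]; first exact: leIl.
    apply: (le_sup (@boolean_distr _ B) Q1 (lex1 _)) => e Qe.
    have [->|/eqP ce0] := eqVneq (Order.meet c e) \bot; first exact: le0x.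
    by apply: zub; split=> //; exists e.
apply: (BR Fp p2) => c pc; split; first exact: PP.
have [P0 PI [Pub P1]] := PP c pc.
have c1 : c <> \top.
  move=> c1; case: p2 => x [y [px py xy]].
  have pE z : p z -> z = c.
    move=> pz; apply: contrapT => zc.
    by apply: p0; rewrite -(pI z c pz pc zc) c1 meetx1.
  by apply: xy; rewrite (pE x)// (pE y).
(* The meet of Q c with the two-block partition at c refines ~` c |` P c: it
   agrees with P c below c and cuts ~` c into further pieces. *)
apply: (Fup _ _ (FI _ _ (bpa_compl c) (FQ c pc))); last first.
  move=> _ [[x [xc _] [e Qe <-]] xe0]; case: xc xe0 => -> xe0.
    by exists (Order.meet c e) => //; right; split=> //; exists e.
  by exists (~` c); [left|exact: leIl].
apply/is_partitionP; split.
- by move=> [c0|//]; apply: c1; rewrite -[c]complK -c0 compl0.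
- have dis z : P c z -> Order.meet (~` c) z = \bot.
    by move=> /Pub zc; apply/eqP; rewrite -lex0 -(meetCx c); exact: leI2.
  move=> x y [->|Px] [->|Py] xy //; [exact: dis|by rewrite meetC dis|exact: PI].
- move=> z zub; apply/eqP; rewrite -le1x -(joinxC c) leUx.
  apply/andP; split; last by apply: zub; left.
  by apply: P1 => x Px; apply: zub; right.
Qed.

(** The elements [b] on which some partition of [F] cuts out pieces belonging
    to members of [C] form a local ideal [K], by gluing. It contains each
    member of [C], hence it is everything, and the partition found for the top
    element is the one sought. *)
Lemma cover_refined (C : set ideal) : is_cover C ->
  exists2 p, F p & forall c, p c -> exists2 I, C I & I c.
Proof.
move=> [_ Cub]; have [[_ [p0 Fp0] _ _] _] := BF.
(* A member of C contains \bot already; the first alternative is there for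
   empty C. *)
pose small b := b = \bot \/ exists2 I, C I & I b.
have small_down a b : b <= a -> small a -> small b.
  move=> ba [a0|[I CI Ia]]; first by left; apply/eqP; rewrite -lex0 -a0.
  by right; exists I => //; exact: ideal_down ba Ia.
pose K := [set b | exists2 q, F q & forall c, q c -> small (Order.meet c b)].
have KP : is_local_ideal F K.
  split=> [|a b ba [q Fq qa]|a p Fp pK].
  - by exists p0 => // c _; left; rewrite meetx0.
  - by exists q => // c /qa; apply: small_down; rewrite leI2.
  have /choice[Q QP] : forall c, exists q, p c -> F q /\
      forall e, q e -> small (Order.meet e (Order.meet a c)).
    move=> c; have [pc|pc] := pselect (p c); last by exists set0.
    by have [q Fq qP] := pK c pc; exists q.
  eexists; first by apply: (locally_refined_partition (Q := Q) Fp) => c /QP[].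
  move=> _ [c pc [[e Qe <-] _]].
  have := (QP c pc).2 e Qe; apply: small_down.
  by rewrite (meetC c e) -meetA (meetC c a).
have /ideal_leP /(_ \top) : \top <= LocalIdeal KP :> ideal.
  apply: Cub => I CI; apply/ideal_leP => a Ia; exists p0 => // c _.
  by right; exists I => //; apply: ideal_down Ia; exact: leIr.
move=> [//|q Fq qP]; exists q => // c qc.
have := qP c qc; rewrite meetx1 => -[c0|//].
by have [q0 _ _] := FP Fq; case: q0; rewrite -c0.
Qed.

Lemma ideal_ultraparacompact : ultraparacompact ideal.
Proof.
split=> [|C /cover_refined[p Fp pC]]; first exact: ideal_zero_dimensional.
exists (principal @` p); first exact: principal_partition.
by move=> _ [c /pC [I CI Ic] <-]; exists I => //; exact/principal_le.
Qed.

(** Such a family is itself a cover by local ideals, so a partition of [F]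
    refines it, and [F] is upward closed. *)
Lemma principal_partition_filter (q : set B) :
  is_partition (principal @` q) -> F q.
Proof.
move=> qP; have [_ _ q1] := qP; have [p Fp pq] := cover_refined q1.
move: qP => /is_partitionP [q0 qI qT].
have [[_ _ Fup _] _] := BF; apply: (Fup _ _ Fp).
  apply/is_partitionP; split.
  - by move=> q0'; apply: q0; exists \bot => //; exact: principal0.
  - move=> a b qa qb ab; apply: principal_inj; rewrite principalI principal0.
    by apply: qI; [exists a|exists b|move/principal_inj].
  - move=> z zub; apply: principal_inj; rewrite principal1; apply: qT.
    by move=> _ [a qa <-]; rewrite principal_mono zub.
by move=> r /pq [_ [a qa <-] ra]; exists a.
Qed.

Hypothesis BS : subcomplete F.

(** A partition of [F] refining the cover by [I] and its complement splits
    into the blocks in [I] and the others; the join of the former, which exists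
    by subcompleteness, generates [I]. *)
Lemma complemented_principal I : complemented I -> exists b, I = principal b.
Proof.
move=> [J [IJ0 IJ1]].
have IJcov : is_cover [set I; J] by rewrite /is_cover -IJ1; exact: sup_of2.
have [p Fp pIJ] := cover_refined IJcov; have [p0 pI _] := FP Fp.
pose R := [set c | p c /\ I c].
have [s [sub slub]] : supremums R !=set0 by apply: (BS Fp) => c [].
exists s; apply/le_anti/andP; split.
  apply/ideal_leP => x Ix; apply: (le_part Fp) => c pc.
  have [K KIJ Kc] := pIJ c pc; case: KIJ Kc => -> cIJ.
    by apply: leIxr; apply: sub.
  suff -> : Order.meet x c = \bot by exact: le0x.
  apply: in_ideal_bot; rewrite -IJ0.
  by split; [apply: ideal_down Ix|apply: ideal_down cIJ]; rewrite ?leIl ?leIr.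
apply/principal_le; apply: (ideal_local Fp) => c pc.
have [Ic|Ic] := pselect (I c); first by apply: ideal_down Ic; exact: leIr.
suff -> : Order.meet s c = \bot by exact: ideal0.
apply/eqP; rewrite disj_leC; apply: slub => r [pr Ir].
by rewrite -disj_leC pI// => rc; apply: Ic; rewrite -rc.
Qed.

End LocalIdealBpa.

(** * Every subcomplete locally refinable algebra is a centre *)

Lemma boolean_morphism_inverse d (A : ctbDistrLatticeType d)
    d' (B : ctbDistrLatticeType d') (f : A -> B) (g : B -> A) :
  boolean_morphism f -> cancel f g -> cancel g f -> boolean_morphism g.
Proof.
move=> [f0 f1 fI fU fC] fK gK; have finj := can_inj fK.
by split=> [||x y|x y|x]; apply: finj; rewrite ?(fI, fU, fC) !gK.
Qed.

Section Representation.
Variable B : bpa.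
Hypothesis BS : subcomplete (@bpa_filter B).
Hypothesis BR : locally_refinable (@bpa_filter B).
Let F := @bpa_filter B.
Let BF : is_bpa F := bpaP B.
Let L : frame := ideal_frame_of F.

Fact principal_in (b : B) : `[< @complemented _ L (principal BF b) >].
Proof. by apply/asboolP; exact: principal_complemented. Qed.

Definition to_centre (b : B) : centre L := Centre (principal_in b).

Fact ex_of_centre (x : centre L) : exists b, (x : L) = principal BF b.
Proof.
by have /asboolP := centre_val_in x; exact: complemented_principal.
Qed.

Definition of_centre (x : centre L) : B := sval (cid (ex_of_centre x)).

Fact of_centreK : cancel of_centre to_centre.
Proof.
by move=> x; apply: centre_inj; exact/esym/(svalP (cid (ex_of_centre x))).
Qed.

Fact to_centreK : cancel to_centre of_centre.
Proof.
move=> b; apply: (@principal_inj _ _ _ BF).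
exact/esym/(svalP (cid (ex_of_centre (to_centre b)))).
Qed.

Fact to_centre_boolean : boolean_morphism to_centre.
Proof.
have mI : Order.meet_morphism to_centre.
  by move=> x y; apply: centre_inj; rewrite centre_meet; exact: principalI.
have mC : {morph to_centre : x / ~` x}.
  move=> x; apply: compl_uniq; apply/centre_complement_pair.
  exact: principalC.
split=> //.
- by apply: centre_inj; rewrite centre0; exact: principal0.
- by apply: centre_inj; rewrite centre1; exact: principal1.
- move=> x y; rewrite -[Order.join x y]complK complU mC mI !mC complI.
  by rewrite !complK.
Qed.

Lemma image_to_centre (p : set B) :
  @centre_val L @` (to_centre @` p) = principal BF @` p.
Proof. by rewrite image_comp. Qed.

Fact to_centre_partition : @partition_morphism B (centre_bpa_of L) to_centre.
Proof.
split=> [|p Fp]; first exact: to_centre_boolean.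
have pP := principal_partition BF Fp.
suff -> : (to_centre @` p) `\ \bot = to_centre @` p.
  by rewrite /= /centre_filter /mkset image_to_centre.
apply/seteqP; split=> [x []//|_ [b pb <-]]; split; first by exists b.
move=> b0; have [+ _ _] := pP; apply; exists b => //.
exact: etrans (congr1 (@centre_val L) b0) (centre0 L).
Qed.

Fact of_centre_partition : @partition_morphism (centre_bpa_of L) B of_centre.
Proof.
split=> [|p Fp].
  exact: boolean_morphism_inverse to_centre_boolean to_centreK of_centreK.
apply: (principal_partition_filter (BF := BF) BR).
rewrite -image_to_centre.
suff -> : to_centre @` ((of_centre @` p) `\ \bot) = p by [].
have [p0 _ _] := (centre_filterP _).1 Fp.
apply/seteqP; split=> [_ [_ [[x px <-] _] <-]|x px].
  by rewrite of_centreK.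
exists (of_centre x); last exact: of_centreK.
split; first by exists x.
move=> x0; apply: p0; have [t0 _ _ _ _] := to_centre_boolean.
by rewrite -t0 -x0 of_centreK.
Qed.

Lemma centre_representation :
  exists e : partition_hom (centre_bpa_of L) B,
    @isomorphism bpa_category (centre_bpa_of L) B e.
Proof.
exists (PartitionHom of_centre_partition).
exists (PartitionHom to_centre_partition).
split; apply: partition_hom_eq => x; [exact: of_centreK|exact: to_centreK].
Qed.

End Representation.

Theorem theorem24 :
  equivalent_categories slr_bpa_category ultraparacompact_frame_category.
Proof.
apply: (equivalence_of_fully_faithful (G := centre_functor)).
- by move=> [L LU] [M MU] f g; apply: centre_hom_inj; exact: LU.1.
- by move=> [L LU] [M MU] h; exists (extension_hom h LU); exact: extension_homK.
- move=> [B [BS BR]].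
  pose L : ultraparacompact_frame_category :=
    exist (fun L : frame => ultraparacompact L)
      (ideal_frame_of (@bpa_filter B)) (ideal_ultraparacompact (bpaP B) BR).
  by exists L; exact: centre_representation.
Qed.
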